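(* Fix a dimension $d\ge2$. There is a constant $C_d$ depending only on $d$ such that the following holds. Let $n,n_0,p$ be positive integers with $p\le n_0\le 2p$, and put $N_0=n_0^d$ and $N=n^d$. Let $I=[n]^d$ be the index set of the uniform tensor grid on $[0,1]^d$ with $n$ points in each direction, let $T_I$ be the tensor node cluster tree constructed by recursive $2^d$ uniform partition, each of whose leaf nodes contains at most $N_0$ points, and let $T_{I\times I}$ be the corresponding tensor node block cluster tree under the weak admissibility condition. If $\boldsymbol{A}^{\mathrm{HTLR}}$ is an HTLR matrix on $T_{I\times I}$ of rank $p$, then the storage required for $\boldsymbol{A}^{\mathrm{HTLR}}$ is at most $C_d\,p^dN$, i.e. it is $O(p^dN)$ with prefactor depending only on $d$.
   Context: Notation: $[n]=\{1,\dots,n\}$, $h=1/n$. Grid: the grid point with multi-index $\boldsymbol{i}=(i_1,\dots,i_d)\in[n]^d$ is $\boldsymbol{x}_{\boldsymbol{i}}=((i_1-\tfrac12)h,\dots,(i_d-\tfrac12)h)$, with computational domain $\Omega_{\boldsymbol{i}}=\prod_\ell[(i_\ell-1)h,i_\ell h]$. For $\tau\subset I$, $\Omega_\tau=\bigcup_{\boldsymbol{i}\in\tau}\Omega_{\boldsymbol{i}}$. Cluster tree: a tree $T_I$ whose nodes are nonempty subsets of $I$, with root $I$, such that each node either has no children (a leaf) or is the disjoint union of its children. It is a tensor node cluster tree if every node has the form $\tau=\tau_1\times\dots\times\tau_d$, with $\tau_\ell$ an index set for the $\ell$-th dimension. Recursive $2^d$ uniform partition: a node $\tau$ with $|\tau|\le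 N_0$ is a leaf and is not partitioned further; a node with $|\tau|>N_0$ is split into (up to) $2^d$ children by splitting each index interval $\tau_\ell$ into two consecutive intervals of sizes as equal as possible (empty children are discarded). Weak admissibility: two nodes $\tau,\sigma$ are admissible if $\Omega_\tau$ and $\Omega_\sigma$ are non-overlapping, i.e. $\Omega_\tau\cap\Omega_\sigma$ has measure zero. Block cluster tree $T_{I\times I}$: built from the root $(I,I)$ as follows. If $\tau,\sigma$ are admissible, $(\tau,\sigma)$ is an admissible leaf; otherwise, if $\tau$ or $\sigma$ is a leaf of $T_I$, $(\tau,\sigma)$ is an inadmissible leaf; otherwise $(\tau,\sigma)$ is a non-leaf node with children all $(\tau',\sigma')\in\operatorname{children}(\tau)\times\operatorname{children}(\sigma)$. It is called a tensor node block cluster tree when $T_I$ is a tensor node cluster tree. HTLR (hierarchical Tucker low-rank) matrix of rank $p$ on $T_{I\times I}$: a matrix $\boldsymbol{A}^{\mathrm{HTLR}}\in\mathbb{R}^{I\times I}$ stored as follows. For an admissible leaf $(\tau,\sigma)$, the block $\boldsymbol{A}^{\mathrm{HTLR}}_{\tau,\sigma}$, viewed as a $2d$-order tensor, is given in Tucker form $\boldsymbol{\mathcal{G}}\times_1\boldsymbol{U}_1\times_2\cdots\times_d\boldsymbol{U}_d\times_{d+1}\boldsymbol{V}_1\times_{d+2}\cdots\times_{2d}\boldsymbol{V}_d$ with $\boldsymbol{U}_\ell\in\mathbb{R}^{|\tau_\ell|\times p}$, $\boldsymbol{V}_\ell\in\mathbb{R}^{|\sigma_\ell|\times p}$, $\boldsymbol{\mathcal{G}}\in\mathbb{R}^{p\times\dots\times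 p}$ ($2d$ modes), where $\times_\ell$ is the mode-$\ell$ product. For an inadmissible leaf, the block is a dense matrix. For a non-leaf node, the block is the block matrix made of the blocks of its children. Storage: the total number of real numbers stored, namely $\sum_\ell(|\tau_\ell|+|\sigma_\ell|)p+p^{2d}$ for each admissible leaf and $|\tau||\sigma|$ for each inadmissible leaf. *)

(* Defs.v *)
From HB Require Import structures.
From mathcomp Require Import all_boot all_order all_algebra.
From mathcomp Require Import boolp classical_sets functions reals ereal.
From mathcomp Require Import topology normedtype sequences.

Set Implicit Arguments.
Unset Strict Implicit.
Unset Printing Implicit Defensive.

Import Order.TTheory GRing.Theory Num.Theory.
Local Open Scope ring_scope.

(* Lebesgue outer measure on R^d, from countable covers by closed boxes; a set
   has measure zero iff its outer measure is 0. *)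

Definition box (R : realType) (d : nat) (a b : 'rV[R]_d) : set 'rV[R]_d :=
  [set x | forall l, a ord0 l <= x ord0 l <= b ord0 l]%classic.

Definition box_cover (R : realType) (d : nat) (A : set 'rV[R]_d)
    (ab : (nat -> 'rV[R]_d) * (nat -> 'rV[R]_d)) : Prop :=
  (forall k l, ab.1 k ord0 l <= ab.2 k ord0 l) /\
  (A `<=` \bigcup_k box (ab.1 k) (ab.2 k))%classic.

Definition lebesgue_outer (R : realType) (d : nat) (A : set 'rV[R]_d) : \bar R :=
  ereal_inf [set (\sum_(0 <= k <oo)
                    (\prod_(l < d) (ab.2 k ord0 l - ab.1 k ord0 l))%:E)%E
            | ab in [set ab | box_cover A ab]]%classic.

(* The elements of [mindex d n] are the multi-indices of [n]^d shifted to start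
   at 0, so [cell i] is the product of the [i_l h, (i_l + 1) h] with h = 1/n. *)

Definition mindex (d n : nat) := {ffun 'I_d -> 'I_n}.

Definition cell (R : realType) (d n : nat) (i : mindex d n) : set 'rV[R]_d :=
  box (\row_l ((i l)%:R / n%:R)) (\row_l ((i l).+1%:R / n%:R)).
Arguments cell R {d n} i.

(* A tensor node tau_1 x ... x tau_d is given by its factors; [idx] is the set
   of multi-indices it denotes. *)

Definition cluster (d n : nat) := {ffun 'I_d -> {set 'I_n}}.

Definition idx (d n : nat) (tau : cluster d n) : {set mindex d n} :=
  [set i : mindex d n | [forall l, i l \in tau l]].

Definition full_cluster (d n : nat) : cluster d n := [ffun=> [set: 'I_n]].

Definition cluster_domain (R : realType) (d n : nat) (tau : cluster d n) :
    set 'rV[R]_d :=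
  (\bigcup_(i in [set` idx tau]) cell R i)%classic.
Arguments cluster_domain R {d n} tau.

Definition admissible (R : realType) (d n : nat) (tau sigma : cluster d n) :
    Prop :=
  lebesgue_outer (cluster_domain R tau `&` cluster_domain R sigma)%classic = 0%E.

(* A leaf is a node with k = 0 children. *)

Inductive ctree (d n : nat) : Type :=
  CNode (tau : cluster d n) (k : nat) (child : 'I_k -> ctree d n).

Definition label (d n : nat) (T : ctree d n) : cluster d n :=
  let: CNode tau _ _ := T in tau.

Fixpoint nodes_ok (d n : nat) (T : ctree d n) : Prop :=
  let: CNode tau k c := T in
  [/\ idx tau != finset.set0,
      (0 < k)%N ->
        idx tau = (\bigcup_(j < k) idx (label (c j)))%SET /\
        (forall j j' : 'I_k, j != j' ->
           [disjoint idx (label (c j)) & idx (label (c j'))])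
    & forall j, nodes_ok (c j)].

Definition tensor_cluster_tree (d n : nat) (T : ctree d n) : Prop :=
  label T = full_cluster d n /\ nodes_ok T.

(* If S is an interval, then lo and hi are consecutive intervals partitioning
   it. For |S| odd either part may be the larger one; for |S| = 1 one of them is
   empty. *)

Definition balanced_split (n : nat) (S lo hi : {set 'I_n}) : Prop :=
  [/\ lo :|: hi = S,
      (forall a b : 'I_n, a \in lo -> b \in hi -> (a < b)%N),
      (#|lo| <= #|hi|.+1)%N
    & (#|hi| <= #|lo|.+1)%N].

Definition pick_halves (d n : nat) (lo hi : cluster d n)
    (e : {ffun 'I_d -> bool}) : cluster d n :=
  [ffun l => if e l then hi l else lo l].

Fixpoint uniform_partition (d n N0 : nat) (T : ctree d n) : Prop :=
  let: CNode tau k c := T in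
  if (#|idx tau| <= N0)%N then k = 0%N
  else exists lo hi : cluster d n,
    [/\ forall l, balanced_split (tau l) (lo l) (hi l),
        perm_eq [seq label (c j) | j <- enum 'I_k]
                [seq tau' <- [seq pick_halves lo hi e
                             | e <- enum {ffun 'I_d -> bool}]
                | idx tau' != finset.set0]
      & forall j, uniform_partition N0 (c j)].

Inductive btree (d n : nat) : Type :=
| BAdm (tau sigma : cluster d n)
| BInadm (tau sigma : cluster d n)
| BNode (tau sigma : cluster d n) (k m : nat)
    (child : 'I_k -> 'I_m -> btree d n).

Fixpoint block_tree (R : realType) (d n : nat) (T S : ctree d n) {struct T} :
    btree d n :=
  let: CNode tau k c := T in
  let: CNode sigma m e := S in
  if `[< admissible R tau sigma >] then BAdm tau sigma
  else if (k == 0%N) || (m == 0%N) then BInadm tau sigma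
  else BNode tau sigma (fun i j => block_tree R (c i) (e j)).

(* The 2d modes of the core are split into d row modes and d column modes. *)

Record tucker (R : realType) (d n p : nat) (tau sigma : cluster d n) : Type :=
  Tucker {
    tucker_U : forall l, 'M[R]_(#|tau l|, p);
    tucker_V : forall l, 'M[R]_(#|sigma l|, p);
    tucker_G : {ffun 'I_d -> 'I_p} -> {ffun 'I_d -> 'I_p} -> R }.

(* The entry at (a, b) of G x_1 U_1 ... x_d U_d x_(d+1) V_1 ... x_(2d) V_d. *)
Definition tucker_entry (R : realType) (d n p : nat) (tau sigma : cluster d n)
    (X : tucker R p tau sigma)
    (a : forall l, 'I_#|tau l|) (b : forall l, 'I_#|sigma l|) : R :=
  \sum_(al : {ffun 'I_d -> 'I_p}) \sum_(be : {ffun 'I_d -> 'I_p})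
    tucker_G X al be * (\prod_(l < d) tucker_U X l (a l) (al l))
                     * (\prod_(l < d) tucker_V X l (b l) (be l)).

Fixpoint htlr_data (R : realType) (d n p : nat) (B : btree d n) : Type :=
  match B with
  | BAdm tau sigma => tucker R p tau sigma
  | BInadm tau sigma => 'M[R]_(#|idx tau|, #|idx sigma|)
  | BNode _ _ _ _ c => forall i j, htlr_data R p (c i j)
  end.

(* [enum_val] turns the a-th row of a block (or the a-th row of a factor U_l)
   into the corresponding element of the node (resp. of tau_l). *)
Fixpoint represents (R : realType) (d n p : nat)
    (A : mindex d n -> mindex d n -> R) (B : btree d n) :
    htlr_data R p B -> Prop :=
  match B return htlr_data R p B -> Prop with
  | BAdm tau sigma => fun X =>
      forall (a : forall l, 'I_#|tau l|) (b : forall l, 'I_#|sigma l|),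
        A [ffun l => enum_val (a l)] [ffun l => enum_val (b l)]
        = tucker_entry X a b
  | BInadm tau sigma => fun D =>
      forall (a : 'I_#|idx tau|) (b : 'I_#|idx sigma|),
        A (enum_val a) (enum_val b) = D a b
  | BNode _ _ _ _ c => fun X => forall i j, represents A (X i j)
  end.

Record htlr_matrix (R : realType) (d n p : nat) (B : btree d n) : Type :=
  HTLRMatrix {
    htlr_mx : mindex d n -> mindex d n -> R;
    htlr_rep : htlr_data R p B;
    htlr_repP : represents htlr_mx htlr_rep }.

Fixpoint data_storage (R : realType) (d n p : nat) (B : btree d n) :
    htlr_data R p B -> nat :=
  match B return htlr_data R p B -> nat with
  | BAdm tau sigma => fun _ =>
      (\sum_(l < d) (#|tau l| + #|sigma l|) * p + p ^ (2 * d))%N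
  | BInadm tau sigma => fun _ => (#|idx tau| * #|idx sigma|)%N
  | BNode _ _ k m c => fun X =>
      (\sum_(i < k) \sum_(j < m) data_storage (X i j))%N
  end.

Definition storage (R : realType) (d n p : nat) (B : btree d n)
    (A : htlr_matrix R p B) : nat := data_storage (htlr_rep A).

(* Main.v *)
Require Import Defs.
From mathcomp Require Import all_boot all_order all_algebra.
From mathcomp Require Import reals.
From mathcomp Require Import boolp classical_sets ereal.
From mathcomp Require Import sequences numfun measure.
From mathcomp Require Import lebesgue_measure measurable_realfun.
From mathcomp Require Import lebesgue_integral zify.

(* Restores [cluster] as the type of tensor nodes, which the set of cluster
   points of a filter would hide. *)
Import Defs.

(** Two nodes with disjoint index sets have domains that meet only along faces
    of cells, a set of measure zero, so they are always admissible
    ([disjoint_admissible]).  A nonempty node is never admissible with itself,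
    because its domain contains a cell ([not_self_admissible]).  Hence the only
    nodes of the block cluster tree that are subdivided are the diagonal pairs
    (tau, tau): the inadmissible leaves are the (tau, tau) with tau a leaf of
    the cluster tree, and every other leaf is an admissible pair of distinct
    siblings.

    If p > 2 n, the root is a leaf.  Otherwise the two kinds of leaves are
    bounded as follows.

    The inadmissible leaves cost |tau|^2 <= N_0 |tau| <= (2 p)^d |tau| each, and
    their sum is at most (2 p)^d N since the leaves of the cluster tree
    partition the grid.

    For the admissible leaves, put a = 2^k.  At level k every side of a node is
    at most n / a + 1, and there are at most a^d nodes, each giving at most 4^d
    pairs of children.  A node that is subdivided has more than n_0^d points,
    hence a side longer than n_0, so p a <= n_0 a <= n.  Level k therefore
    contributes at most

      level_cost a = 4^d (4 d a^(d-1) n p + a^d p^(2 d)).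

    For d >= 2 this at least doubles from one level to the next
    ([level_cost_double]), so the sum over the levels is at most twice the last
    term, and p a <= n makes that term O(p^d N) ([level_cost_le]).  The
    hypothesis d >= 2 is what makes the linear term a^(d-1) n p grow
    geometrically.  The geometric sum is carried out by an induction over the
    cluster tree in [diag_storage_le]. *)

Set Implicit Arguments.
Unset Strict Implicit.
Unset Printing Implicit Defensive.

(** * Outer measure of boxes and admissibility *)

Section OuterMeasure.
Import Order.TTheory GRing.Theory Num.Theory.
Local Open Scope ring_scope.
Local Open Scope classical_set_scope.

Lemma prod_side_ge0 (R : realType) (m : nat) (a b : nat -> R) :
  (forall l, a l <= b l) -> 0 <= \prod_(l < m) (b l - a l).
Proof. by move=> h; apply: prodr_ge0 => l _; rewrite subr_ge0. Qed.

(** Countable subadditivity of the volume.  The weights make an induction on the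
    dimension possible: when the last coordinate is fixed to t, the cover
    becomes a cover in one dimension less, in which the k-th weight is
    multiplied by the indicator of the k-th side at t.  Integrating the bound
    for the slices over t gives the bound for the box. *)
Lemma volume_le_weighted_cover (R : realType) (m : nat) (u v : nat -> R)
    (a b : nat -> nat -> R) (w : nat -> R) :
    (forall l, u l <= v l) -> (forall k l, a k l <= b k l) ->
    (forall k, 0 <= w k) ->
    (forall x : nat -> R, (forall l, (l < m)%N -> u l <= x l <= v l) ->
      (1 <= \sum_(0 <= k <oo)
              (w k * \prod_(l < m) \1_`[a k l, b k l] (x l))%:E)%E) ->
  ((\prod_(l < m) (v l - u l))%:E <=
    \sum_(0 <= k <oo) (w k * \prod_(l < m) (b k l - a k l))%:E)%E.
Proof.
move=> uv ab; elim: m w => [|m IH] w w0 cov.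
  have := cov u (fun l => ltac:(by [])); rewrite big_ord0.
  under eq_eseriesr do rewrite big_ord0.
  by under [in X in _ -> X]eq_eseriesr do rewrite big_ord0.
have slice t : u m <= t <= v m ->
    ((\prod_(l < m) (v l - u l))%:E <= \sum_(0 <= k <oo)
       (w k * \1_`[a k m, b k m] t * \prod_(l < m) (b k l - a k l))%:E)%E.
  move=> tm; apply: IH => [k|x xm]; first by rewrite mulr_ge0.
  pose y l := if l == m then t else x l.
  have := cov y; rewrite /y => /(_ _)/le_trans; apply.
    move=> l; rewrite ltnS leq_eqVlt => /orP[/eqP->|lm]; first by rewrite eqxx.
    by rewrite ltn_eqF// xm.
  apply: lee_nneseries => [k _ _|k _].
    by rewrite lee_fin mulr_ge0// prodr_ge0.
  rewrite lee_fin big_ord_recr/= eqxx -mulrA [_ * \1__ t]mulrC.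
  rewrite le_eqVlt; apply/orP; left; apply/eqP; congr (_ * (_ * _)).
  by apply: eq_bigr => l _; rewrite ltn_eqF.
rewrite big_ord_recr/= EFinM.
have mD : measurable `[u m, v m] by exact: measurable_itv.
have lenE (c e : R) : c <= e -> lebesgue_measure `[c, e] = (e - c)%:E.
  move=> ce; rewrite lebesgue_measure_itv/= lte_fin; case: ltP => //.
  by move=> ec; rewrite (@le_anti _ _ c e) ?subrr// ce ec.
have V0 k : 0 <= w k * \prod_(l < m) (b k l - a k l).
  by rewrite mulr_ge0// prod_side_ge0.
have mI k : measurable_fun `[u m, v m] (\1_`[a k m, b k m] : R -> R).
  exact: measurable_indic.
pose f k t :=
  (w k * \1_`[a k m, b k m] t * \prod_(l < m) (b k l - a k l))%:E.
have mf k : measurable_fun `[u m, v m] (f k).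
  apply/measurable_EFinP; apply: measurable_funM => //.
  exact: measurable_funM.
have f0 k t : (0 <= f k t)%E by rewrite lee_fin mulrAC mulr_ge0.
rewrite -(lenE _ _ (uv m)) -(integral_cst lebesgue_measure mD).
apply: (@le_trans _ _ (\int[lebesgue_measure]_(t in `[u m, v m])
   \sum_(0 <= k <oo) f k t)%E).
  apply: ge0_le_integral => //.
  - by move=> t _; rewrite lee_fin prod_side_ge0.
  - apply: (@ge0_emeasurable_sum _ _ _ _ _ predT) => k.
    + by move=> t _ _; exact: f0.
    + by move=> _; exact: mf.
rewrite integral_nneseries//.
apply: lee_nneseries => [k _ _|k _]; first by apply: integral_ge0.
under eq_integral do rewrite /f mulrAC EFinM.
rewrite ge0_integralZl_EFin//; last first.
  by apply/measurable_EFinP.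
rewrite integral_indic//.
rewrite big_ord_recr/= mulrA [leRHS]EFinM lee_wpmul2l ?lee_fin//.
rewrite -lenE//; apply: le_measure; rewrite ?inE//; exact: measurableI.
Qed.

Lemma outer_measure_box_gt0 (R : realType) (d : nat) (u v : 'rV[R]_d.+1)
    (A : set 'rV[R]_d.+1) :
  (forall l, u ord0 l < v ord0 l) -> box u v `<=` A -> (0 < lebesgue_outer A)%E.
Proof.
move=> uv uvA.
apply: (@lt_le_trans _ _ (\prod_(l < d.+1) (v ord0 l - u ord0 l))%:E).
  by rewrite lte_fin prodr_gt0// => l _; rewrite subr_gt0.
apply: le_ereal_inf_tmp => _ [[a b] [/= ab Aab] <-].
pose ext (z : 'rV[R]_d.+1) (l : nat) : R := z ord0 (inord l).
have extE z (l : 'I_d.+1) : ext z l = z ord0 l by rewrite /ext inord_val.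
under eq_bigr do rewrite -!extE.
have sideE k : \prod_(l < d.+1) (b k ord0 l - a k ord0 l) =
    1 * \prod_(l < d.+1) (ext (b k) l - ext (a k) l).
  by rewrite mul1r; apply: eq_bigr => l _; rewrite !extE.
under eq_eseriesr do rewrite sideE.
apply: (@volume_le_weighted_cover _ _ (ext u) (ext v)
  (fun k => ext (a k)) (fun k => ext (b k)) (fun=> 1)) => [l|k l|//|x ux];
  [exact/ltW/uv|exact: ab|].
pose y : 'rV[R]_d.+1 := \row_l x l.
have [k _ yk] : (\bigcup_k box (a k) (b k)) y.
  by apply/Aab/uvA => l; rewrite !mxE -!extE; exact: ux.
under eq_eseriesr do rewrite mul1r.
(* The box containing y already contributes 1 to the sum of the indicators. *)
apply: le_trans (nneseries_lim_ge k.+1 _); last first.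
  by move=> i _ _; rewrite lee_fin prodr_ge0.
rewrite big_nat_recr//= [X in (_ + X%:E)%E]big1 => [|l _].
  by rewrite leeDr// sume_ge0// => i _; rewrite lee_fin prodr_ge0.
rewrite indicE mem_set//= in_itv/=.
by have := yk l; rewrite !mxE -!extE.
Qed.

(** Boxes with a degenerate side have volume zero; the finite cover is completed
    to a countable one by copies of the origin. *)
Lemma outer_measure_finite_flat (R : realType) (d : nat) (J : finType)
    (u v : J -> 'rV[R]_d.+1) (A : set 'rV[R]_d.+1) :
    (forall j l, u j ord0 l <= v j ord0 l) ->
    (forall j, exists l, u j ord0 l = v j ord0 l) ->
    A `<=` \bigcup_j box (u j) (v j) ->
  lebesgue_outer A = 0%E.
Proof.
move=> uv flat Auv; apply/eqP; rewrite eq_le; apply/andP; split; last first.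
  apply: le_ereal_inf_tmp => _ [[a b] [/= ab _] <-].
  apply: nneseries_ge0 => k _ _; rewrite lee_fin prodr_ge0// => l _.
  by rewrite subr_ge0.
pose ext (z : J -> 'rV[R]_d.+1) k :=
  if (insub k : option 'I_#|J|) is Some i then z (enum_val i) else 0.
apply: ereal_inf_lbound; exists (ext u, ext v) => /=.
  split=> [k l|x /Auv[j _ xj]] /=.
    by rewrite /ext; case: insub => [i|]; rewrite ?uv// !mxE.
  exists (enum_rank j : nat) => //.
  by rewrite /ext valK enum_rankK.
apply: eseries0 => k _ _ ; congr EFin; apply/eqP/prodf_eq0.
rewrite /ext; case: insub => [i|]; last by exists ord0; rewrite // !mxE subrr.
by have [l ul] := flat (enum_val i); exists l; rewrite // ul subrr.
Qed.

(** Two distinct cells that meet have indices differing by at most one in each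
    coordinate, and they meet in the box whose sides are the intersections of
    their sides.  This box is flat in every coordinate where the indices
    differ. *)
Lemma disjoint_admissible (R : realType) (d n : nat)
    (tau sigma : cluster d.+1 n) :
  [disjoint idx tau & idx sigma]%B -> admissible R tau sigma.
Proof.
case: n tau sigma => [|n] tau sigma dis.
  apply: (@outer_measure_finite_flat _ _ void (fun=> 0) (fun=> 0)); [by []..|].
  by move=> x [[i _ _] _]; case: (i ord0).
pose idx_pair := (mindex d.+1 n.+1 * mindex d.+1 n.+1)%type.
pose touching (ij : idx_pair) := (ij.1 != ij.2) &&
  [forall l, maxn (ij.1 l) (ij.2 l) <= minn (ij.1 l) (ij.2 l) + 1]%N.
pose corner (f : nat -> nat -> nat) (m : nat) (ij : idx_pair) : 'rV[R]_d.+1 :=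
  \row_l ((f (ij.1 l) (ij.2 l) + m)%N%:R / n.+1%:R).
apply: (@outer_measure_finite_flat _ _ {ij | touching ij}
  (fun ij => corner maxn 0%N (val ij)) (fun ij => corner minn 1%N (val ij))).
- move=> [[i j] /= /andP[_ /forallP h]] l; rewrite !mxE/=.
  by rewrite ler_pM2r ?invr_gt0 ?ltr0n// ler_nat addn0 h.
- move=> [[i j] /= /andP[/eqP ij /forallP h]].
  have [l il] : exists l, i l != j l.
    apply/existsP; apply: contra_notT ij => /existsPn e; apply/ffunP => l.
    by apply/eqP; rewrite -[_ == _]negbK e.
  exists l; rewrite !mxE/=; congr (_%:R / _).
  have := h l; move: il; rewrite -val_eqE/= addn0 /maxn /minn addn1.
  by case: ltngtP => // ij' _ h'; apply/eqP; rewrite eqn_leq h' ij'.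
- move=> x [[i /= i_t xi] [j /= j_s xj]].
  have ij : i != j.
    by apply: contraTneq i_t => ->; rewrite (disjointFl dis).
  have h : [forall l, maxn (i l) (j l) <= minn (i l) (j l) + 1]%N.
    apply/forallP => l; move: (xi l) (xj l).
    rewrite !mxE => /andP[a b] /andP[a' b'].
    have := le_trans a b'; have := le_trans a' b.
    rewrite !ler_pM2r ?invr_gt0 ?ltr0n// !ler_nat addn1 => h1 h2.
    by rewrite /maxn /minn; case: ltngtP => // ->.
  have hij : touching (i, j) by rewrite /touching ij h.
  exists (Sub (i, j) hij) => // l; rewrite !mxE /= addn0.
  move: (xi l) (xj l); rewrite !mxE => /andP[a b] /andP[a' b'].
  by rewrite /maxn /minn !addn1; case: ltngtP => e; rewrite ?a ?b ?a' ?b'.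
Qed.

Lemma not_self_admissible (R : realType) (d n : nat) (tau : cluster d.+1 n) :
  idx tau != finset.set0 -> ~ admissible R tau tau.
Proof.
move=> /finset.set0Pn[i itau] adm.
have n0 : (0 < n)%N by apply: leq_ltn_trans (ltn_ord (i ord0)).
suff : (0 < lebesgue_outer (cluster_domain R tau `&` cluster_domain R tau))%E.
  by rewrite adm ltxx.
apply: (@outer_measure_box_gt0 R d
  (\row_l ((i l)%:R / n%:R)) (\row_l ((i l).+1%:R / n%:R))).
  by move=> l; rewrite !mxE ltr_pM2r ?invr_gt0 ?ltr0n// ltr_nat.
by move=> x xi; split; exists i.
Qed.

End OuterMeasure.

(** * The uniform partition *)

Lemma card_idx (d n : nat) (tau : cluster d n) :
  #|idx tau| = \prod_(l < d) #|tau l|.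
Proof.
have -> : #|idx tau| = #|family (fun l => mem (tau l))|.
  by apply: eq_card => i; rewrite inE.
by rewrite card_family foldrE big_map big_enum.
Qed.

Lemma balanced_split_card (n : nat) (S lo hi : {set 'I_n}) :
  balanced_split S lo hi ->
  #|lo|.*2 <= #|S|.+1 /\ #|hi|.*2 <= #|S|.+1.
Proof.
case=> <- lohi lo_hi hi_lo.
have -> : #|lo :|: hi| = #|lo| + #|hi|.
  rewrite cardsU disjoint_setI0 ?cards0 ?subn0//.
  apply/pred0P => x /=; apply/negP => /andP[xlo xhi].
  by have := lohi _ _ xlo xhi; rewrite ltnn.
lia.
Qed.

(** Discarding empty children cannot discard all of them, since any point of tau
    lies in the child that takes in each direction the half containing it. *)
Lemma partition_children (d n k : nat) (tau lo hi : cluster d n)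
    (c : 'I_k -> cluster d n) :
    idx tau != finset.set0 ->
    (forall l, balanced_split (tau l) (lo l) (hi l)) ->
    perm_eq [seq c j | j <- enum 'I_k]
            [seq tau' <- [seq pick_halves lo hi e
                         | e <- enum {ffun 'I_d -> bool}]
            | idx tau' != finset.set0] ->
  0 < k <= 2 ^ d /\ forall j l, #|c j l|.*2 <= #|tau l|.+1.
Proof.
move=> /finset.set0Pn[i i_tau] split kids; split.
  apply/andP; split.
    rewrite -[k]card_ord cardE -(size_map c) (perm_size kids) -has_predT.
    apply/hasP; pose e := [ffun l => i l \in hi l].
    exists (pick_halves lo hi e) => //; rewrite mem_filter.
    rewrite map_f ?mem_enum// andbT; apply/finset.set0Pn; exists i.
    rewrite inE; apply/forallP => l; rewrite !ffunE.
    case: ifPn => // i_hi; have [split_l _ _ _] := split l.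
    move: i_tau; rewrite inE => /forallP/(_ l); rewrite -split_l inE.
    by rewrite (negPf i_hi) orbF.
  have := perm_size kids; rewrite size_map size_enum_ord => ->.
  rewrite size_filter (leq_trans (count_size _ _))// size_map -cardE.
  by rewrite card_ffun card_bool card_ord.
move=> j l; have : c j \in [seq c j | j <- enum 'I_k].
  by apply: map_f; rewrite mem_enum.
rewrite (perm_mem kids) mem_filter => /andP[_ /mapP[e _ ->]].
have [hlo hhi] := balanced_split_card (split l).
by rewrite ffunE; case: (e l).
Qed.

Lemma card_tree_children (d n k : nat) (tau : cluster d n)
    (c : 'I_k -> ctree d n) :
    idx tau = \bigcup_(j < k) idx (label (c j)) ->
    (forall j j' : 'I_k, j != j' ->
       [disjoint idx (label (c j)) & idx (label (c j'))]) ->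
  #|idx tau| = \sum_(j < k) #|idx (label (c j))|.
Proof.
move=> -> dis; rewrite -sum1_card partition_disjoint_bigcup//.
by apply: eq_bigr => j _; rewrite sum1_card.
Qed.

(** * Storage of the diagonal blocks *)

(** The storage does not depend on the stored numbers, which allows reasoning on
    the block tree alone. *)
Fixpoint block_storage (d n p : nat) (B : btree d n) : nat :=
  match B with
  | BAdm tau sigma =>
      \sum_(l < d) (#|tau l| + #|sigma l|) * p + p ^ (2 * d)
  | BInadm tau sigma => #|idx tau| * #|idx sigma|
  | BNode _ _ k m c => \sum_(i < k) \sum_(j < m) block_storage p (c i j)
  end.

Lemma data_storageE (R : realType) (d n p : nat) (B : btree d n)
    (X : htlr_data R p B) :
  data_storage X = block_storage p B.
Proof.
elim: B X => //= tau sigma k m c IH X.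
by apply: eq_bigr => i _; apply: eq_bigr => j _; apply: IH.
Qed.

Lemma block_tree_admissible (R : realType) (d n : nat) (T S : ctree d n) :
  admissible R (label T) (label S) ->
  block_tree R T S = BAdm (label T) (label S).
Proof. by case: T => ? ? ?; case: S => ? ? ? /= h; rewrite asboolT. Qed.

Lemma block_tree_diag_leaf (R : realType) (d n : nat) (tau : cluster d.+1 n)
    (c : 'I_0 -> ctree d.+1 n) :
  idx tau != finset.set0 ->
  block_tree R (CNode tau c) (CNode tau c) = BInadm tau tau.
Proof. by move=> /(@not_self_admissible R) h /=; rewrite asboolF. Qed.

(** Among the pairs of children of tau, the off-diagonal ones are admissible
    leaves.  The factor x leaves room for the scaling by a^d in the induction on
    the tree. *)
Lemma diag_storage_split (R : realType) (d n p k x M : nat)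
    (tau : cluster d.+1 n) (c : 'I_k -> ctree d.+1 n) :
    nodes_ok (CNode tau c) -> 0 < k ->
    (forall i j,
       x * block_storage p (BAdm (label (c i)) (label (c j))) <= M) ->
  x * block_storage p (block_tree R (CNode tau c) (CNode tau c)) <=
    x * \sum_(j < k) block_storage p (block_tree R (c j) (c j)) + k ^ 2 * M.
Proof.
move=> /= [/(@not_self_admissible R) nadm /[swap] _ kids] k0 cM.
have [_ dis] := kids k0.
rewrite asboolF// -[k == 0]negbK -lt0n k0/=.
have -> : k ^ 2 * M = \sum_(i < k) k * M.
  by rewrite sum_nat_const card_ord mulnA.
rewrite !big_distrr -big_split; apply: leq_sum => i _ /=.
rewrite (bigD1 i)//= mulnDr leq_add2l big_distrr/=.
apply: (@leq_trans (\sum_(j < k | j != i) M)).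
  apply: leq_sum => j ji; rewrite block_tree_admissible; first exact: cM.
  by apply: disjoint_admissible; apply: dis; rewrite eq_sym.
by rewrite sum_nat_const leq_mul2r (leq_trans (max_card _)) ?card_ord ?orbT.
Qed.

(** * Cost of a level of the tree *)

(** At scale a = 2^k, this bounds a^d times the storage of one admissible leaf
    formed by two children of a node of level k. *)
Definition pair_cost (d n p a : nat) : nat :=
  4 * d * (a ^ d.-1 * n * p) + a ^ d * p ^ (2 * d).

Definition level_cost (d n p a : nat) : nat := 4 ^ d * pair_cost d n p a.

Lemma pair_cost_ge (d n p a : nat) (tau sigma : cluster d n) :
    0 < d -> (forall l, a * #|tau l| <= 2 * n) ->
    (forall l, a * #|sigma l| <= 2 * n) ->
  a ^ d * block_storage p (BAdm tau sigma) <= pair_cost d n p a.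
Proof.
case: d tau sigma => // d tau sigma _ ht hs.
rewrite /pair_cost /= mulnDr leq_add// big_distrr/=.
apply: (@leq_trans (\sum_(l < d.+1) 4 * (a ^ d * n * p))).
  apply: leq_sum => l _; rewrite expnS.
  have : a * #|tau l| + a * #|sigma l| <= 4 * n.
    by have := leq_add (ht l) (hs l); lia.
  move: #|tau l| #|sigma l| (a ^ d) => x y z xy.
  have -> : a * z * ((x + y) * p) = (a * x + a * y) * (z * p) by lia.
  by apply: leq_trans (leq_mul xy (leqnn (z * p))) _; lia.
by rewrite sum_nat_const card_ord mulnCA mulnA.
Qed.

Lemma double_exp_le (a e : nat) : 0 < e -> 2 * a ^ e <= (2 * a) ^ e.
Proof.
by move=> e0; rewrite expnMn leq_mul// -[X in X <= _]expn1 leq_pexp2l.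
Qed.

Lemma level_cost_double (d n p a : nat) :
  1 < d -> 2 * level_cost d n p a <= level_cost d n p (2 * a).
Proof.
move=> d1; rewrite /level_cost /pair_cost mulnCA leq_mul2l mulnDr.
have d0 : 0 < d.-1 by lia.
have := double_exp_le a d0; have := double_exp_le a (ltnW d1).
move: (a ^ _) ((2 * a) ^ _) (a ^ _) ((2 * a) ^ _) => x x' y y' xx' yy'.
have -> : 2 * (4 * d * (x * n * p)) = 4 * d * (2 * x * n * p) by lia.
apply/orP; right; rewrite leq_add//; first by rewrite leq_mul2l !leq_mul ?orbT.
by rewrite mulnA leq_mul.
Qed.

Lemma level_cost_le (d n p a : nat) : 0 < d -> 0 < p -> p * a <= 2 * n ->
  level_cost d n p a <= 8 ^ d * (4 * d).+1 * (p ^ d * n ^ d).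
Proof.
case: d => // d _ p0 pa; rewrite /level_cost /pair_cost /=.
have linear : a ^ d * n * p <= 2 ^ d.+1 * (p ^ d.+1 * n ^ d.+1).
  (* The d spare factors p >= 1 turn a^d into (p a)^d. *)
  apply: (@leq_trans ((p * a) ^ d * (n * p))).
    by rewrite mulnA leq_mul// leq_mul// expnMn leq_pmull// expn_gt0 p0.
  apply: (@leq_trans ((2 * n) ^ d * (n * p))).
    by rewrite leq_mul//; case: (d) => // e; rewrite leq_exp2r.
  rewrite expnMn (expnSr n) (expnSr p) (expnSr 2).
  have : 0 < p ^ d by rewrite expn_gt0 p0.
  move: (2 ^ d) (n ^ d) (p ^ d) => x y z; nia.
have constant : a ^ d.+1 * p ^ (2 * d.+1) <= 2 ^ d.+1 * (p ^ d.+1 * n ^ d.+1).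
  rewrite mul2n -addnn expnD mulnA -expnMn [a * p]mulnC.
  by rewrite [X in _ <= _ * X]mulnC mulnA -(expnMn 2) leq_mul// leq_exp2r.
rewrite [8 ^ _](expnMn 4 2) -[X in _ <= X]mulnA -[X in _ <= X]mulnA.
rewrite leq_mul2l; apply/orP; right.
rewrite [X in _ <= X]mulnCA mulSn addnC leq_add// leq_mul2l.
by apply/orP; right.
Qed.

(** Here a stands for 2^k when T is at level k.  The levels coarser than k cost
    together at most [level_cost a], which is reserved on the left.  In the step
    from T to its children the reserve grows to level_cost (2 a), at least twice
    as much, so that it also pays for the admissible leaves at level k.  The
    bound p a <= 2 n is p (a / 2) <= n at the parent of T, which is subdivided;
    for the root, where a = 1, it is an assumption. *)
Lemma diag_storage_le (R : realType) (d n n0 p a : nat) (T : ctree d.+1 n) :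
    0 < d -> 0 < p -> p <= n0 <= 2 * p -> 0 < a -> p * a <= 2 * n ->
    nodes_ok T -> uniform_partition (n0 ^ d.+1) T ->
    (forall l, a * #|label T l| <= n + a) ->
  a ^ d.+1 * block_storage p (block_tree R T T) + level_cost d.+1 n p a <=
    a ^ d.+1 * ((2 * p) ^ d.+1 * #|idx (label T)|) +
    8 ^ d.+1 * (4 * d.+1).+1 * (p ^ d.+1 * n ^ d.+1).
Proof.
move=> d0 p0 /andP[pn0 n0p].
elim: T a => tau k c IH a a0 pa; rewrite [label _]/= => ok up size_tau.
case: (leqP #|idx tau| (n0 ^ d.+1)) => [small|large].
  have k0 : k = 0 by move: up; rewrite /= small.
  subst k; case: ok => ne _ _.
  rewrite leq_add ?level_cost_le// leq_mul2l; apply/orP; right.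
  rewrite block_tree_diag_leaf//= leq_mul2r (leq_trans small) ?orbT//.
  by rewrite leq_exp2r.
rewrite /= leqNgt large /= in up; case: up => lo [hi [split perm up]].
have ok' := ok; case: ok' => ne kids okc.
have [/andP[k0 kd] size_c] := partition_children ne split perm.
have [idx_tau dis] := kids k0.
have n0a_le : n0 * a <= n.
  (* Otherwise the number of points, the product of the sides, would be at
     most n0^d. *)
  have [l hl] : exists l, n0 < #|tau l|.
    apply/existsP; apply: contraTT large => /existsPn h; rewrite -leqNgt.
    rewrite card_idx -[X in _ ^ X]card_ord -prod_nat_const.
    by apply: leq_prod => l _; rewrite leqNgt.
  by have := leq_mul (leqnn a) hl; have := size_tau l; lia.
have pa_le : p * a <= n0 * a by rewrite leq_mul2r pn0 orbT.
have half j l : 2 * a * #|label (c j) l| <= n + 2 * a.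
  have := size_tau l; have : a * #|label (c j) l|.*2 <= a * #|tau l|.+1.
    by rewrite leq_mul2l size_c orbT.
  rewrite -mul2n; lia.
have a_le : a <= p * a by rewrite leq_pmull.
have pa2 : p * (2 * a) <= 2 * n by lia.
have kid j : (2 * a) ^ d.+1 * block_storage p (block_tree R (c j) (c j)) +
    level_cost d.+1 n p (2 * a) <=
    (2 * a) ^ d.+1 * ((2 * p) ^ d.+1 * #|idx (label (c j))|) +
    8 ^ d.+1 * (4 * d.+1).+1 * (p ^ d.+1 * n ^ d.+1).
  by apply: (IH j (2 * a) _ pa2 (okc j) (up j) (half j)); rewrite muln_gt0.
have cost_le := @level_cost_le d.+1 n p (2 * a) isT p0 pa2.
have cost2 := level_cost_double n p a (d0 : 1 < d.+1).
have couple i j : a ^ d.+1 *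
    block_storage p (BAdm (label (c i)) (label (c j))) <= pair_cost d.+1 n p a.
  by apply: pair_cost_ge => // l; [have := half i l|have := half j l]; lia.
have := @diag_storage_split R _ _ _ _ _ _ _ _ ok k0 couple.
have : k ^ 2 * pair_cost d.+1 n p a <= level_cost d.+1 n p a.
  by rewrite leq_mul2r [4 ^ _](expnAC 2 2) leq_exp2r// kd orbT.
rewrite (card_tree_children idx_tau dis).
have : a ^ d.+1 * (\sum_(j < k) block_storage p (block_tree R (c j) (c j))) +
    level_cost d.+1 n p (2 * a) <=
    a ^ d.+1 * ((2 * p) ^ d.+1 * \sum_(j < k) #|idx (label (c j))|) +
    8 ^ d.+1 * (4 * d.+1).+1 * (p ^ d.+1 * n ^ d.+1).
  move: cost_le kid; rewrite expnMn.
  move: (8 ^ _ * _ * _) (level_cost _ _ _ (2 * a)) => Z E EZ kid.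
  rewrite -(leq_pmul2l (expn_gt0 2 d.+1 : 0 < 2 ^ d.+1)).
  have : \sum_(j < k) (2 ^ d.+1 * a ^ d.+1 *
             block_storage p (block_tree R (c j) (c j)) + E) <=
         \sum_(j < k) (2 ^ d.+1 * a ^ d.+1 *
             ((2 * p) ^ d.+1 * #|idx (label (c j))|) + Z).
    by apply: leq_sum => j _; apply: kid.
  rewrite !big_split /= -!big_distrr /= !sum_nat_const card_ord.
  (* The 2^d - k discarded children enter with storage 0: for such a child the
     claim reads E <= Z. *)
  have : (2 ^ d.+1 - k) * E <= (2 ^ d.+1 - k) * Z by rewrite leq_mul2l EZ orbT.
  rewrite !mulnBl; have := leq_mul kd (leqnn E); have := leq_mul kd (leqnn Z).
  rewrite !mulnDr !mulnA. lia.
lia.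
Qed.

(** * The bound on the storage *)

Theorem proposition3p8 (d : nat) (hd : (2 <= d)%N) :
  exists C : nat,
  forall (R : realType) (n n0 p : nat),
    (0 < n)%N -> (0 < n0)%N -> (0 < p)%N -> (p <= n0 <= 2 * p)%N ->
  forall T : ctree d n,
    tensor_cluster_tree T -> uniform_partition (n0 ^ d) T ->
  forall A : htlr_matrix R p (block_tree R T T),
    (storage A <= C * (p ^ d * n ^ d))%N.
Proof.
exists (2 ^ d + 8 ^ d * (4 * d).+1).
case: d hd => // d hd R n n0 p n_gt0 n0_gt0 p_gt0 p_n0 T [full ok] up A.
rewrite /storage data_storageE.
have card_root : #|idx (label T)| = n ^ d.+1.
  rewrite full card_idx -[X in _ ^ X]card_ord -prod_nat_const.
  by apply: eq_bigr => l _; rewrite ffunE cardsT card_ord.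
rewrite mulnDl -(mul1n (block_storage _ _)).
have [pn|np] := leqP p (2 * n).
  have := @diag_storage_le R d n n0 p 1 T hd p_gt0 p_n0 isT.
  rewrite muln1 exp1n !mul1n card_root expnMn -mulnA => /(_ pn ok up) le.
  apply: leq_trans (leq_addr _ _) (le _) => l.
  by rewrite mul1n full ffunE cardsT card_ord leq_addr.
rewrite mul1n; apply: leq_trans (leq_addr _ _).
case: T A full ok up card_root => tau k c A full ok up card_root.
have small : #|idx tau| <= n0 ^ d.+1.
  by rewrite [#|_|]card_root leq_exp2r//; lia.
have k0 : k = 0 by move: up; rewrite /= small.
subst k; case: ok => ne _ _.
rewrite block_tree_diag_leaf//= mulnA -expnMn; apply: leq_mul.
  by rewrite (leq_trans small)// leq_exp2r//; case/andP: p_n0.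
by rewrite [#|_|]card_root.
Qed.
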